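(* Let $\mathbf P$ be a full subcategory of a symmetric monoidal category $\mathbf C=(\mathbf C,\otimes,I)$. Suppose that the functor $-\otimes V\colon\mathbf C\to\mathbf C$ has a right adjoint $\mathbf{hom}(V,-)$ for every $V\in\mathbf P$. Let $\mathbb M=(X,\mu_X,\eta_X)$ be a monoid in $\mathbf C$. Then the adjunction bijections $$\theta\colon\mathrm{Hom}\big(X,\mathbf{hom}(V,V)\big)\xrightarrow{\ \sim\ }\mathrm{Hom}\big(X\otimes V,V\big),\qquad V\in\mathbf P,$$ give a fully faithful functor embedding the category $\mathrm{Rep}_{\mathbf P}(\mathbb M)$ into $\mathrm{Lact}(\mathbb M)$ (on objects $(V,\rho)\mapsto(V,\theta(\rho))$, on morphisms $f\mapsto f$). In particular, if the symmetric monoidal category $\mathbf C$ is closed, then (taking $\mathbf P=\mathbf C$) one obtains an equivalence between the categories $\mathrm{Rep}_{\mathbf C}(\mathbb M)$ and $\mathrm{Lact}(\mathbb M)$.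
   Context: Composition of morphisms is written $f\cdot g$; monoidal categories are treated as strict. The right adjoints assemble into a bifunctor $\mathbf{hom}\colon\mathbf P^{\mathrm{op}}\times\mathbf C\to\mathbf C$ with isomorphisms $\theta_{X,Y,Z}\colon\mathrm{Hom}(X,\mathbf{hom}(Y,Z))\to\mathrm{Hom}(X\otimes Y,Z)$ natural in $X,Z\in\mathbf C$, $Y\in\mathbf P$. Put $\mathrm{ev}_{Y,Z}=\theta(\mathrm{id}_{\mathbf{hom}(Y,Z)})\colon\mathbf{hom}(Y,Z)\otimes Y\to Z$. For $V\in\mathbf P$ put $c_V=\theta^{-1}\big(\mathrm{ev}_{V,V}\cdot(\mathrm{id}\otimes\mathrm{ev}_{V,V})\big)\colon\mathbf{hom}(V,V)\otimes\mathbf{hom}(V,V)\to\mathbf{hom}(V,V)$ and $u_V=\theta^{-1}(\mathrm{id}_V)\colon I\to\mathbf{hom}(V,V)$ (using $I\otimes V=V$); then $\mathbf{end}(V)=(\mathbf{hom}(V,V),c_V,u_V)$ is a monoid in $\mathbf C$. A representation of $\mathbb M$ on $V\in\mathbf P$ is a monoid morphism $\rho\colon\mathbb M\to\mathbf{end}(V)$, i.e. a morphism $\rho\colon X\to\mathbf{hom}(V,V)$ with $\rho\cdot\mu_X=c_V\cdot(\rho\otimes\rho)$ and $\rho\cdot\eta_X=u_V$. The category $\mathrm{Rep}_{\mathbf P}(\mathbb M)$ has as objects pairs $(V,\rho)$, with $V\in\mathbf P$ and $\rho$ a representation of $\mathbb M$ on $V$; a morphism $(V,\rho)\to(V',\rho')$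 is a morphism $f\colon V\to V'$ in $\mathbf P$ with $\mathbf{hom}(\mathrm{id}_V,f)\cdot\rho=\mathbf{hom}(f,\mathrm{id}_{V'})\cdot\rho'$. A (left) action of $\mathbb M$ on $V\in\mathbf C$ is a morphism $a\colon X\otimes V\to V$ with $a\cdot(\mathrm{id}_X\otimes a)=a\cdot(\mu_X\otimes\mathrm{id}_V)$ and $a\cdot(\eta_X\otimes\mathrm{id}_V)=\mathrm{id}_V$. The category $\mathrm{Lact}(\mathbb M)$ has as objects pairs $(V,a)$ and as morphisms $(V,a)\to(V',a')$ the morphisms $f\colon V\to V'$ in $\mathbf C$ with $f\cdot a=a'\cdot(\mathrm{id}_X\otimes f)$. A symmetric monoidal category is closed if every $-\otimes V$ has a right adjoint. *)

(* Defs.v *)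
(* Equality of morphisms is Leibniz equality. Proof irrelevance is used to
   compare pairs (morphism, proof that it preserves a structure). *)
From Stdlib Require Import ProofIrrelevance Setoid.

Set Implicit Arguments.
Unset Strict Implicit.
Unset Printing Implicit Defensive.

Declare Scope cat_scope.
Delimit Scope cat_scope with cat.
Local Open Scope cat_scope.

Record category : Type := Category {
  ob :> Type;
  Hom : ob -> ob -> Type;
  idm : forall X, Hom X X;
  comp : forall X Y Z, Hom Y Z -> Hom X Y -> Hom X Z;
  comp_idl : forall X Y (f : Hom X Y), comp (idm Y) f = f;
  comp_idr : forall X Y (f : Hom X Y), comp f (idm X) = f;
  comp_assoc : forall W X Y Z (f : Hom Y Z) (g : Hom X Y) (h : Hom W X),
    comp f (comp g h) = comp (comp f g) h
}.
Arguments Hom {c} X Y.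
Arguments idm {c} X.
Arguments comp {c X Y Z} f g.

(* [f · g] is "first g, then f". *)
Notation "f · g" := (comp f g) (at level 40, left associativity) : cat_scope.

Definition op_cat (C : category) : category.
Proof.
refine (@Category C (fun X Y => @Hom C Y X) (@idm C)
          (fun X Y Z f g => g · f) _ _ _).
- intros; apply comp_idr.
- intros; apply comp_idl.
- intros; symmetry; apply comp_assoc.
Defined.

Definition prod_cat (C D : category) : category.
Proof.
refine (@Category (C * D)
          (fun X Y => (Hom (fst X) (fst Y) * Hom (snd X) (snd Y))%type)
          (fun X => (idm (fst X), idm (snd X)))
          (fun X Y Z f g => (fst f · fst g, snd f · snd g)) _ _ _).
- intros X Y [f g]; simpl; now rewrite !comp_idl.
- intros X Y [f g]; simpl; now rewrite !comp_idr.
- intros; simpl; now rewrite !comp_assoc.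
Defined.

(* A full subcategory is given by the class [P] of its objects. *)
Record sub_ob (C : category) (P : C -> Prop) : Type := SubOb {
  sub_val :> C;
  sub_prop : P sub_val
}.

Definition full_subcat (C : category) (P : C -> Prop) : category.
Proof.
refine (@Category (sub_ob P) (fun V W => @Hom C V W)
          (fun V => @idm C V) (fun _ _ _ f g => f · g) _ _ _).
- intros; apply comp_idl.
- intros; apply comp_idr.
- intros; apply comp_assoc.
Defined.

Record functor (C D : category) : Type := Functor {
  fob :> C -> D;
  fmap : forall X Y : C, Hom X Y -> Hom (fob X) (fob Y);
  fmap_id : forall X, fmap (idm X) = idm (fob X);
  fmap_comp : forall X Y Z (f : Hom Y Z) (g : Hom X Y),
    fmap (f · g) = fmap f · fmap g
}.
Arguments fmap {C D} f {X Y} _ : rename.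

Definition id_functor (C : category) : functor C C.
Proof. now refine (@Functor C C (fun X => X) (fun _ _ f => f) _ _). Defined.

Definition comp_functor (C D E : category) (G : functor D E) (F : functor C D) :
  functor C E.
Proof.
refine (@Functor C E (fun X => G (F X)) (fun _ _ f => fmap G (fmap F f)) _ _).
- intros; now rewrite !fmap_id.
- intros; now rewrite !fmap_comp.
Defined.

Record iso (C : category) (X Y : C) : Type := Iso {
  iso_hom :> Hom X Y;
  iso_inv : Hom Y X;
  iso_hom_inv : iso_hom · iso_inv = idm Y;
  iso_inv_hom : iso_inv · iso_hom = idm X
}.
Arguments iso_hom {C X Y} i.
Arguments iso_inv {C X Y} i.

Record nat_iso (C D : category) (F G : functor C D) : Type := NatIso {
  nat_iso_at :> forall X, iso (F X) (G X);
  nat_iso_natural : forall X Y (f : Hom X Y),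
    nat_iso_at Y · fmap F f = fmap G f · nat_iso_at X
}.

Definition fully_faithful (C D : category) (F : functor C D) : Prop :=
  forall (X Y : C) (g : Hom (F X) (F Y)), exists! f : Hom X Y, fmap F f = g.

Definition injective_on_objects (C D : category) (F : functor C D) : Prop :=
  forall X Y : C, F X = F Y -> X = Y.

Definition is_equivalence (C D : category) (F : functor C D) : Prop :=
  exists G : functor D C,
    inhabited (nat_iso (comp_functor G F) (id_functor C)) /\
    inhabited (nat_iso (comp_functor F G) (id_functor D)).

Record right_adjoint (C D : category) (F : functor C D) : Type := RightAdjoint {
  radj :> functor D C;
  radj_theta : forall (X : C) (Z : D), Hom X (radj Z) -> Hom (F X) Z;
  radj_theta_inv : forall (X : C) (Z : D), Hom (F X) Z -> Hom X (radj Z);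
  radj_thetaK : forall X Z (f : Hom X (radj Z)),
    radj_theta_inv (radj_theta f) = f;
  radj_theta_invK : forall X Z (g : Hom (F X) Z),
    radj_theta (radj_theta_inv g) = g;
  radj_natural : forall X X' Z Z' (g : Hom Z Z') (h : Hom X (radj Z))
      (k : Hom X' X),
    radj_theta (fmap radj g · h · k) = g · radj_theta h · fmap F k
}.

(* Not assumed strict: the associativity and unit constraints that are
   suppressed in the strict notation appear explicitly, so that for instance
   an action law reads a · (id ⊠ a) · associator = a · (mu ⊠ id). *)
Record monoidal_category : Type := MonoidalCategory {
  mon_cat :> category;
  tensor : mon_cat -> mon_cat -> mon_cat;
  tensorm : forall X X' Y Y' : mon_cat,
    Hom X X' -> Hom Y Y' -> Hom (tensor X Y) (tensor X' Y');
  tensorm_id : forall X Y, tensorm (idm X) (idm Y) = idm (tensor X Y);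
  tensorm_comp : forall X X' X'' Y Y' Y''
      (f : Hom X' X'') (f' : Hom X X') (g : Hom Y' Y'') (g' : Hom Y Y'),
    tensorm (f · f') (g · g') = tensorm f g · tensorm f' g';
  unit_ob : mon_cat;
  associator : forall X Y Z,
    iso (tensor (tensor X Y) Z) (tensor X (tensor Y Z));
  left_unitor : forall X, iso (tensor unit_ob X) X;
  right_unitor : forall X, iso (tensor X unit_ob) X;
  associator_natural : forall X X' Y Y' Z Z'
      (f : Hom X X') (g : Hom Y Y') (h : Hom Z Z'),
    associator X' Y' Z' · tensorm (tensorm f g) h =
    tensorm f (tensorm g h) · associator X Y Z;
  left_unitor_natural : forall X X' (f : Hom X X'),
    left_unitor X' · tensorm (idm unit_ob) f = f · left_unitor X;
  right_unitor_natural : forall X X' (f : Hom X X'),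
    right_unitor X' · tensorm f (idm unit_ob) = f · right_unitor X;
  pentagon : forall W X Y Z,
    associator W X (tensor Y Z) · associator (tensor W X) Y Z =
    tensorm (idm W) (associator X Y Z) · associator W (tensor X Y) Z
      · tensorm (associator W X Y) (idm Z);
  triangle : forall X Y,
    tensorm (idm X) (left_unitor Y) · associator X unit_ob Y =
    tensorm (right_unitor X) (idm Y)
}.
Arguments tensor {m} X Y.
Arguments tensorm {m X X' Y Y'} f g.
Arguments unit_ob {m}.
Arguments associator {m} X Y Z.
Arguments left_unitor {m} X.
Arguments right_unitor {m} X.

Notation "X ⊗ Y" := (tensor X Y) (at level 39, left associativity) : cat_scope.
Notation "f ⊠ g" := (tensorm f g) (at level 39, left associativity) : cat_scope.

Record symmetric_monoidal_category : Type := SymmetricMonoidalCategory {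
  sym_mon :> monoidal_category;
  braiding : forall X Y : sym_mon, Hom (X ⊗ Y) (Y ⊗ X);
  braiding_natural : forall (X X' Y Y' : sym_mon)
      (f : Hom X X') (g : Hom Y Y'),
    braiding X' Y' · (f ⊠ g) = (g ⊠ f) · braiding X Y;
  braiding_sym : forall X Y, braiding Y X · braiding X Y = idm (X ⊗ Y);
  hexagon : forall X Y Z : sym_mon,
    associator Y Z X · braiding X (Y ⊗ Z) · associator X Y Z =
    (idm Y ⊠ braiding X Z) · associator Y X Z · (braiding X Y ⊠ idm Z)
}.

Definition tensor_right (C : monoidal_category) (V : C) : functor C C.
Proof.
refine (@Functor C C (fun X => X ⊗ V) (fun _ _ f => f ⊠ idm V) _ _).
- intros; apply tensorm_id.
- intros; now rewrite <- tensorm_comp, comp_idl.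
Defined.

Record monoid (C : monoidal_category) : Type := Monoid {
  mon_ob :> C;
  mon_mul : Hom (mon_ob ⊗ mon_ob) mon_ob;
  mon_unit : Hom unit_ob mon_ob;
  mon_mulA : mon_mul · (mon_mul ⊠ idm mon_ob) =
    mon_mul · (idm mon_ob ⊠ mon_mul) · associator mon_ob mon_ob mon_ob;
  mon_mul1l : mon_mul · (mon_unit ⊠ idm mon_ob) = left_unitor mon_ob;
  mon_mul1r : mon_mul · (idm mon_ob ⊠ mon_unit) = right_unitor mon_ob
}.
Arguments mon_mul {C} m.
Arguments mon_unit {C} m.

Definition is_monoid_morphism (C : monoidal_category) (M N : monoid C)
    (f : Hom M N) : Prop :=
  f · mon_mul M = mon_mul N · (f ⊠ f) /\ f · mon_unit M = mon_unit N.

Definition internal_homs (C : monoidal_category) (P : C -> Prop) : Type :=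
  forall V : sub_ob P, right_adjoint (tensor_right V).

Definition closed (C : monoidal_category) : Type :=
  forall V : C, right_adjoint (tensor_right V).

Definition all_objects (C : category) : C -> Prop := fun _ => True.

Definition closed_internal_homs (C : monoidal_category) (cl : closed C) :
  internal_homs (@all_objects C) := fun V => cl V.

Section InternalHom.
Variables (C : monoidal_category) (P : C -> Prop) (H : internal_homs P).
Implicit Types (X Z : C) (Y V : sub_ob P).

Definition ihom Y Z : C := H Y Z.

Definition theta X Y Z (f : Hom X (ihom Y Z)) : Hom (X ⊗ Y) Z :=
  @radj_theta _ _ _ (H Y) X Z f.

Definition theta_inv X Y Z (g : Hom (X ⊗ Y) Z) : Hom X (ihom Y Z) :=
  @radj_theta_inv _ _ _ (H Y) X Z g.

Definition ev Y Z : Hom (ihom Y Z ⊗ Y) Z := theta (idm (ihom Y Z)).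

(* The action of hom on morphisms: the only one that makes [theta] natural
   in all variables and agrees with the given right adjoints, see
   [theta_natural] and [ihom_map_radj] below. *)
Definition ihom_map Y Y' Z Z' (f : @Hom C Y' Y) (g : Hom Z Z') :
  Hom (ihom Y Z) (ihom Y' Z') :=
  theta_inv (g · ev Y Z · (idm (ihom Y Z) ⊠ f)).

Definition c_end V : Hom (ihom V V ⊗ ihom V V) (ihom V V) :=
  theta_inv (ev V V · (idm (ihom V V) ⊠ ev V V)
               · associator (ihom V V) (ihom V V) V).

Definition u_end V : Hom unit_ob (ihom V V) :=
  theta_inv (left_unitor V : Hom (unit_ob ⊗ V) V).

Lemma thetaK X Y Z (f : Hom X (ihom Y Z)) : theta_inv (theta f) = f.
Proof. apply radj_thetaK. Qed.

Lemma theta_invK X Y Z (g : Hom (X ⊗ Y) Z) : theta (theta_inv g) = g.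
Proof. exact (@radj_theta_invK _ _ _ (H Y) X Z g). Qed.

Lemma theta_inj X Y Z (f g : Hom X (ihom Y Z)) : theta f = theta g -> f = g.
Proof. intros E; rewrite <- (thetaK f), E; apply thetaK. Qed.

Lemma theta_comp X X' Y Z (h : Hom X (ihom Y Z)) (k : Hom X' X) :
  theta (h · k) = theta h · (k ⊠ idm (Y : C)).
Proof.
pose proof (@radj_natural _ _ _ (H Y) X X' Z Z (idm Z) h k) as E.
rewrite fmap_id, !comp_idl in E; exact E.
Qed.

Lemma thetaE X Y Z (h : Hom X (ihom Y Z)) : theta h = ev Y Z · (h ⊠ idm (Y : C)).
Proof. unfold ev; now rewrite <- theta_comp, comp_idl. Qed.

Lemma ihom_map_radj Y Z Z' (g : Hom Z Z') :
  ihom_map (idm (Y : C)) g = fmap (H Y) g.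
Proof.
apply theta_inj; unfold ihom_map; rewrite theta_invK, tensorm_id, comp_idr.
pose proof (@radj_natural _ _ _ (H Y) _ _ _ _ g (idm (ihom Y Z)) (idm _)) as E.
rewrite fmap_id, !comp_idr in E; symmetry; exact E.
Qed.

Lemma theta_natural X X' Y Y' Z Z' (f : @Hom C Y' Y) (g : Hom Z Z')
    (h : Hom X (ihom Y Z)) (k : Hom X' X) :
  theta (ihom_map f g · h · k) = g · theta h · (k ⊠ f).
Proof.
rewrite theta_comp, theta_comp; unfold ihom_map; rewrite theta_invK, (thetaE h).
rewrite <- !comp_assoc, <- !tensorm_comp, !comp_idl, !comp_idr; reflexivity.
Qed.

Lemma theta_ihom_map X Y Y' Z Z' (f : @Hom C Y' Y) (g : Hom Z Z')
    (h : Hom X (ihom Y Z)) :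
  theta (ihom_map f g · h) = g · theta h · (idm X ⊠ f).
Proof.
rewrite <- (comp_idr (ihom_map f g · h)); apply theta_natural.
Qed.

Definition ihom_functor :
  functor (prod_cat (op_cat (full_subcat P)) C) C.
Proof.
refine (@Functor (prod_cat (op_cat (full_subcat P)) C) C
          (fun YZ => ihom (fst YZ) (snd YZ))
          (fun _ _ fg => ihom_map (fst fg) (snd fg)) _ _).
- intros [Y Z]; simpl; rewrite ihom_map_radj; apply fmap_id.
- intros [Y Z] [Y' Z'] [Y'' Z''] [f g] [f' g']; simpl in *; apply theta_inj.
  rewrite theta_ihom_map.
  unfold ihom_map; rewrite !theta_invK.
  rewrite <- !comp_assoc, <- !tensorm_comp, !comp_idl; reflexivity.
Defined.

End InternalHom.
Arguments ihom {C P} H Y Z.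
Arguments theta {C P} H {X Y Z} f.
Arguments theta_inv {C P} H {X Y Z} g.
Arguments ev {C P} H Y Z.
Arguments ihom_map {C P} H {Y Y' Z Z'} f g.
Arguments c_end {C P} H V.
Arguments u_end {C P} H V.

Lemma tensorm_idl_comp (C : monoidal_category) (A X Y Z : C) (f : Hom Y Z)
    (g : Hom X Y) : idm A ⊠ (f · g) = (idm A ⊠ f) · (idm A ⊠ g).
Proof. now rewrite <- tensorm_comp, comp_idl. Qed.

Lemma unit_tensor_inj (C : monoidal_category) (X Y : C) (f g : Hom X Y) :
  idm unit_ob ⊠ f = idm unit_ob ⊠ g -> f = g.
Proof.
intros E.
rewrite <- (comp_idr f), <- (comp_idr g), <- (iso_hom_inv (left_unitor X)).
now rewrite !comp_assoc, <- !left_unitor_natural, E.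
Qed.

Lemma iso_epi (C : category) (X Y Z : C) (i : iso X Y) (f g : Hom Y Z) :
  f · i = g · i -> f = g.
Proof.
intros E; rewrite <- (comp_idr f), <- (comp_idr g), <- (iso_hom_inv i).
now rewrite !comp_assoc, E.
Qed.

Lemma left_unitor_tensor (C : monoidal_category) (A B : C) :
  left_unitor (A ⊗ B) · associator unit_ob A B = left_unitor A ⊠ idm B.
Proof.
apply unit_tensor_inj.
apply (iso_epi (i := associator unit_ob (unit_ob ⊗ A) B)).
assert (epi : forall Z (f g : Hom ((unit_ob ⊗ (unit_ob ⊗ A)) ⊗ B) Z),
  f · (associator unit_ob unit_ob A ⊠ idm B) =
  g · (associator unit_ob unit_ob A ⊠ idm B) -> f = g).
{ intros Z f g Efg.
  assert (K : (associator unit_ob unit_ob A ⊠ idm B) ·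
              (iso_inv (associator unit_ob unit_ob A) ⊠ idm B) = idm _).
  { now rewrite <- tensorm_comp, iso_hom_inv, comp_idl, tensorm_id. }
  now rewrite <- (comp_idr f), <- (comp_idr g), <- K, !comp_assoc, Efg. }
apply epi.
rewrite <- (comp_idl (idm unit_ob)) at 1; rewrite tensorm_comp.
rewrite <- !comp_assoc, (comp_assoc (idm unit_ob ⊠ associator _ _ _)).
rewrite <- pentagon, comp_assoc, triangle.
rewrite <- (tensorm_id A B), <- associator_natural, <- triangle.
rewrite <- (comp_idl (idm B)) at 1; rewrite tensorm_comp.
now rewrite !comp_assoc, <- associator_natural.
Qed.

Definition end_monoid (C : monoidal_category) (P : C -> Prop)
    (H : internal_homs P) (V : sub_ob P) : monoid C.
Proof.
assert (Ec : forall X (h : Hom X (ihom H V V ⊗ ihom H V V)),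
  theta H (c_end H V · h) = ev H V V · (idm _ ⊠ ev H V V)
    · associator _ _ (V : C) · (h ⊠ idm (V : C))).
{ intros X h; rewrite theta_comp; unfold c_end; now rewrite theta_invK. }
assert (Evc : ev H V V · (c_end H V ⊠ idm (V : C)) =
  ev H V V · (idm _ ⊠ ev H V V) · associator _ _ (V : C)).
{ rewrite <- thetaE; unfold c_end; apply theta_invK. }
assert (Evu : ev H V V · (u_end H V ⊠ idm (V : C)) = left_unitor (V : C)).
{ rewrite <- thetaE; unfold u_end; apply theta_invK. }
refine (@Monoid C (ihom H V V) (c_end H V) (u_end H V) _ _ _);
  apply (theta_inj (H := H)).
- rewrite (theta_comp _ (iso_hom (associator _ _ _))), !Ec.
  set (e := ev H V V) in *; set (c := c_end H V) in *.
  transitivity (e · ((idm _ ⊠ e) · (idm _ ⊠ (idm _ ⊠ e)))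
    · (associator (ihom H V V) (ihom H V V) (ihom H V V ⊗ V)
       · associator (ihom H V V ⊗ ihom H V V) (ihom H V V) V)).
  + rewrite <- comp_assoc, (associator_natural c), tensorm_id.
    rewrite <- !comp_assoc, (comp_assoc (idm _ ⊠ e) (c ⊠ _)), <- tensorm_comp.
    rewrite comp_idl, comp_idr.
    assert (Ei : c ⊠ e = (c ⊠ idm (V : C)) · (idm _ ⊠ e)).
    { now rewrite <- tensorm_comp, comp_idl, comp_idr. }
    rewrite Ei, !comp_assoc, Evc.
    rewrite <- (tensorm_id (ihom H V V)), <- (comp_assoc _ (associator _ _ _)).
    now rewrite (associator_natural (idm _) (idm _) e), !comp_assoc.
  + rewrite pentagon, <- (comp_assoc _ _ ((idm _ ⊠ c) ⊠ _)).
    rewrite (associator_natural (idm _) c), !comp_assoc.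
    rewrite <- (comp_assoc e (_ ⊠ e) (_ ⊠ (c ⊠ _))), <- tensorm_comp, Evc.
    now rewrite comp_idl, !tensorm_idl_comp, !comp_assoc.
- rewrite Ec, <- comp_assoc, associator_natural, tensorm_id, !comp_assoc.
  rewrite <- (comp_assoc (ev H V V)), <- tensorm_comp, comp_idl, comp_idr.
  assert (Ei : u_end H V ⊠ ev H V V =
               (u_end H V ⊠ idm (V : C)) · (idm _ ⊠ ev H V V)).
  { now rewrite <- tensorm_comp, comp_idl, comp_idr. }
  rewrite Ei, comp_assoc, Evu, left_unitor_natural, <- comp_assoc.
  now rewrite left_unitor_tensor, <- thetaE.
- rewrite Ec, <- comp_assoc, associator_natural, !comp_assoc.
  rewrite <- (comp_assoc (ev H V V)), <- tensorm_comp, comp_idl, Evu.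
  now rewrite <- comp_assoc, triangle, <- thetaE.
Defined.

Definition is_representation (C : monoidal_category) (P : C -> Prop)
    (H : internal_homs P) (M : monoid C) (V : sub_ob P)
    (rho : Hom M (ihom H V V)) : Prop :=
  is_monoid_morphism (M := M) (N := end_monoid H V) rho.

Record representation (C : monoidal_category) (P : C -> Prop)
    (H : internal_homs P) (M : monoid C) : Type := Representation {
  rep_ob : sub_ob P;
  rep_mor : Hom M (ihom H rep_ob rep_ob);
  rep_morP : is_representation rep_mor
}.
Arguments rep_ob {C P H M} r.
Arguments rep_mor {C P H M} r.

Definition is_rep_morphism (C : monoidal_category) (P : C -> Prop)
    (H : internal_homs P) (M : monoid C) (R R' : representation H M)
    (f : @Hom C (rep_ob R) (rep_ob R')) : Prop :=
  ihom_map H (idm (rep_ob R : C)) f · rep_mor R =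
  ihom_map H f (idm (rep_ob R' : C)) · rep_mor R'.

Definition is_action (C : monoidal_category) (M : monoid C) (V : C)
    (a : Hom (M ⊗ V) V) : Prop :=
  a · (idm (M : C) ⊠ a) · associator M M V = a · (mon_mul M ⊠ idm V) /\
  a · (mon_unit M ⊠ idm V) = left_unitor V.

Record action (C : monoidal_category) (M : monoid C) : Type := Action {
  act_ob : C;
  act_mor : Hom (M ⊗ act_ob) act_ob;
  act_morP : is_action act_mor
}.
Arguments act_ob {C M} a.
Arguments act_mor {C M} a.

Definition is_act_morphism (C : monoidal_category) (M : monoid C)
    (A A' : action M) (f : Hom (act_ob A) (act_ob A')) : Prop :=
  f · act_mor A = act_mor A' · (idm (M : C) ⊠ f).

Lemma sig_eq (T : Type) (Q : T -> Prop) (x y : {t : T | Q t}) :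
  proj1_sig x = proj1_sig y -> x = y.
Proof.
destruct x as [x p], y as [y q]; simpl; intros <-.
now rewrite (proof_irrelevance _ p q).
Qed.

Definition Rep (C : monoidal_category) (P : C -> Prop)
    (H : internal_homs P) (M : monoid C) : category.
Proof.
unshelve refine (@Category (representation H M)
  (fun R R' => {f : @Hom C (rep_ob R) (rep_ob R') | is_rep_morphism f})
  (fun R => exist _ (@idm C (rep_ob R)) _)
  (fun R R' R'' f g => exist _ (proj1_sig f · proj1_sig g) _) _ _ _).
- reflexivity.
- destruct f as [f Ef], g as [g Eg]; simpl; unfold is_rep_morphism in *.
  apply (f_equal (theta H)) in Ef; apply (f_equal (theta H)) in Eg.
  apply (theta_inj (H := H)); rewrite !theta_ihom_map in *.
  rewrite !tensorm_id, !comp_idl, !comp_idr in *.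
  rewrite <- comp_assoc, Eg, comp_assoc, Ef.
  now rewrite <- comp_assoc, <- tensorm_idl_comp.
- intros; apply sig_eq, comp_idl.
- intros; apply sig_eq, comp_idr.
- intros; apply sig_eq, comp_assoc.
Defined.

Definition Lact (C : monoidal_category) (M : monoid C) : category.
Proof.
unshelve refine (@Category (action M)
  (fun A A' => {f : Hom (act_ob A) (act_ob A') | is_act_morphism f})
  (fun A => exist _ (idm (act_ob A)) _)
  (fun A A' A'' f g => exist _ (proj1_sig f · proj1_sig g) _) _ _ _).
- unfold is_act_morphism; now rewrite tensorm_id, comp_idl, comp_idr.
- destruct f as [f Ef], g as [g Eg]; simpl; unfold is_act_morphism in *.
  now rewrite <- comp_assoc, Eg, comp_assoc, Ef, <- comp_assoc, tensorm_idl_comp.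
- intros; apply sig_eq, comp_idl.
- intros; apply sig_eq, comp_idr.
- intros; apply sig_eq, comp_assoc.
Defined.

(* The assignment (V, rho) |-> (V, theta rho), f |-> f. That it is well
   defined on objects and on morphisms is not established here: the proofs are
   arguments, and their existence is part of the theorem. *)
Definition theta_ob (C : monoidal_category) (P : C -> Prop)
    (H : internal_homs P) (M : monoid C)
    (theta_action :
       forall R : representation H M, is_action (theta H (rep_mor R)))
    (R : representation H M) : action M :=
  Action (theta_action R).

Definition theta_functor (C : monoidal_category) (P : C -> Prop)
    (H : internal_homs P) (M : monoid C)
    (theta_action :
       forall R : representation H M, is_action (theta H (rep_mor R)))
    (theta_morphism :
       forall (R R' : representation H M) (f : @Hom C (rep_ob R) (rep_ob R')),
         is_rep_morphism f ->
         is_act_morphism (A := theta_ob theta_action R)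
                         (A' := theta_ob theta_action R') f) :
  functor (Rep H M) (Lact M).
Proof.
refine (@Functor (Rep H M) (Lact M) (theta_ob theta_action)
  (fun R R' f => exist _ (proj1_sig f) (theta_morphism R R' _ (proj2_sig f)))
  _ _).
- intros; now apply sig_eq.
- intros; now apply sig_eq.
Defined.

(* Main.v *)
From Stdlib Require Import ProofIrrelevance.
Require Import Defs.

(** The bijection [theta] transposes both sides of each equation that defines a
    representation, or a morphism of representations, and turns it into the
    corresponding equation for actions.  Since [theta rho = ev · (rho ⊠ id)],
    the product [c_end · (rho ⊠ rho)] becomes the iterated action
    [theta rho · (id ⊠ theta rho)], the unit [u_end] becomes the left unit
    constraint, and the two composites compared by a morphism of
    representations become [f · theta rho] and [theta rho' · (id ⊠ f)].  As
    [theta] is injective, these translations are equivalences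
    ([representation_iff_action], [rep_morphism_iff]).

    The second equivalence says that representations and actions have the same
    morphisms, whence full faithfulness.  The first makes [theta_inv] send an
    action on an object of [P] to a representation ([action_rep]), strictly
    inverse to [theta]; this gives injectivity on objects.  When [P] contains
    every object, the same construction is defined on all actions and is a
    quasi-inverse functor, both comparison isomorphisms being carried by
    identity morphisms of [C]. *)

Local Open Scope cat_scope.

Section Transposition.
Context {C : monoidal_category} {P : C -> Prop} {H : internal_homs P}
  {M : monoid C}.

(** Transposing the composition of [hom(V,V)] yields iterated evaluation;
    naturality of the associator then moves the two copies of [rho] onto the
    two evaluations. *)
Lemma theta_c_end_square (X : C) (V : sub_ob P) (rho : Hom X (ihom H V V)) :
  theta H (c_end H V · (rho ⊠ rho)) =
  theta H rho · (idm X ⊠ theta H rho) · associator X X V.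
Proof.
rewrite theta_comp; unfold c_end; rewrite theta_invK.
rewrite <- comp_assoc, associator_natural, !(thetaE (H := H) rho), !comp_assoc.
f_equal; rewrite <- !comp_assoc; f_equal.
now rewrite <- !tensorm_comp, !comp_idl, !comp_idr.
Qed.

Lemma representation_iff_action (V : sub_ob P) (rho : Hom M (ihom H V V)) :
  is_representation rho <-> is_action (theta H rho).
Proof.
unfold is_representation, is_monoid_morphism, is_action; simpl.
assert (Emul : theta H (rho · mon_mul M) =
               theta H rho · (mon_mul M ⊠ idm (V : C))) by apply theta_comp.
assert (Eunit : theta H (rho · mon_unit M) =
                theta H rho · (mon_unit M ⊠ idm (V : C))) by apply theta_comp.
assert (Eu : theta H (u_end H V) = left_unitor (V : C)) by apply theta_invK.
rewrite <- Emul, <- Eunit, <- Eu, <- theta_c_end_square.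
split; intros [Hmul Hunit]; split.
- now rewrite Hmul.
- now rewrite Hunit.
- now apply (theta_inj (H := H)).
- now apply (theta_inj (H := H)).
Qed.

Lemma rep_morphism_iff (R R' : representation H M)
    (f : @Hom C (rep_ob R) (rep_ob R')) :
  is_rep_morphism f <->
  f · theta H (rep_mor R) = theta H (rep_mor R') · (idm (M : C) ⊠ f).
Proof.
pose proof (theta_ihom_map (H := H) (idm (rep_ob R : C)) f (rep_mor R)) as E.
pose proof (theta_ihom_map (H := H) f (idm (rep_ob R' : C)) (rep_mor R')) as E'.
rewrite tensorm_id, comp_idr in E; rewrite comp_idl in E'.
rewrite <- E, <- E'; unfold is_rep_morphism; split; intros Ef.
- now rewrite Ef.
- now apply (theta_inj (H := H)).
Qed.

Lemma theta_is_action (R : representation H M) :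
  is_action (theta H (rep_mor R)).
Proof. apply representation_iff_action, rep_morP. Qed.

Lemma theta_is_act_morphism (R R' : representation H M)
    (f : @Hom C (rep_ob R) (rep_ob R')) :
  is_rep_morphism f ->
  is_act_morphism (A := theta_ob theta_is_action R)
                  (A' := theta_ob theta_is_action R') f.
Proof. apply rep_morphism_iff. Qed.

Lemma theta_inv_is_representation (A : action M) (p : P (act_ob A)) :
  is_representation (V := SubOb (P := P) p)
    (theta_inv H (act_mor A : Hom (M ⊗ SubOb (P := P) p) (SubOb (P := P) p))).
Proof.
apply representation_iff_action; rewrite theta_invK; apply act_morP.
Qed.

Definition action_rep (A : action M) (p : P (act_ob A)) : representation H M :=
  Representation (theta_inv_is_representation A p).

Lemma theta_action_rep (A : action M) (p : P (act_ob A)) :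
  theta H (rep_mor (action_rep A p)) = act_mor A.
Proof. exact (theta_invK H (Y := SubOb (P := P) p) _). Qed.

Lemma representation_eq (V : sub_ob P) (rho rho' : Hom M (ihom H V V))
    (r : is_representation rho) (r' : is_representation rho') :
  rho = rho' -> Representation r = Representation r'.
Proof. intros <-; f_equal; apply proof_irrelevance. Qed.

(** A strict equality of pairs: the carrier is recovered from the action, so
    that no transport along an equality of objects is involved. *)
Lemma action_rep_theta_ob (R : representation H M)
    (p : P (act_ob (theta_ob theta_is_action R))) :
  action_rep (theta_ob theta_is_action R) p = R.
Proof.
destruct R as [[V q] rho r]; simpl in p.
rewrite (proof_irrelevance _ p q).
apply representation_eq, thetaK.
Qed.

Lemma theta_functor_fully_faithful :
  fully_faithful (theta_functor theta_is_act_morphism).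
Proof.
intros R R' g.
exists (exist _ (proj1_sig g) (proj2 (rep_morphism_iff R R' _) (proj2_sig g))).
split.
- now apply sig_eq.
- intros f <-; now apply sig_eq.
Qed.

(** The representation [R] is read off from [theta_ob R] alone, up to the proof
    that its carrier lies in [P]. *)
Lemma theta_functor_injective_on_objects :
  injective_on_objects (theta_functor theta_is_act_morphism).
Proof.
intros R R' E.
change (theta_ob theta_is_action R = theta_ob theta_is_action R') in E.
rewrite <- (action_rep_theta_ob R (sub_prop (rep_ob R))).
rewrite <- (action_rep_theta_ob R' (sub_prop (rep_ob R'))).
(* The two membership proofs become comparable only after the carriers have
   been identified. *)
generalize (sub_prop (rep_ob R) : P (act_ob (theta_ob theta_is_action R))).
generalize (sub_prop (rep_ob R') : P (act_ob (theta_ob theta_is_action R'))).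
rewrite E; intros p p'; f_equal; apply proof_irrelevance.
Qed.

Section AllObjects.
Variable allP : forall V : C, P V.

Lemma action_rep_is_rep_morphism (A A' : action M)
    (f : Hom (act_ob A) (act_ob A')) :
  is_act_morphism f ->
  is_rep_morphism (R := action_rep A (allP _)) (R' := action_rep A' (allP _)) f.
Proof. intros Ef; apply rep_morphism_iff; rewrite !theta_action_rep; exact Ef. Qed.

Definition action_rep_functor : functor (Lact M) (Rep H M).
Proof.
refine (@Functor (Lact M) (Rep H M) (fun A => action_rep A (allP _))
  (fun A A' f => exist _ (proj1_sig f)
     (action_rep_is_rep_morphism A A' _ (proj2_sig f))) _ _).
- intros; now apply sig_eq.
- intros; now apply sig_eq.
Defined.

(** The two representations are equal by [action_rep_theta_ob], but a
    comparison transported along that equality would not have a visible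
    underlying morphism.  Taking the identity of the common carrier instead
    makes naturality in [R] immediate. *)
Lemma is_rep_morphism_idm_to (R : representation H M) :
  is_rep_morphism (R := action_rep (theta_ob theta_is_action R) (allP _))
    (R' := R) (idm (rep_ob R : C)).
Proof.
apply rep_morphism_iff; rewrite theta_action_rep.
now rewrite tensorm_id, comp_idl, comp_idr.
Qed.

Lemma is_rep_morphism_idm_from (R : representation H M) :
  is_rep_morphism (R := R)
    (R' := action_rep (theta_ob theta_is_action R) (allP _))
    (idm (rep_ob R : C)).
Proof.
apply rep_morphism_iff; rewrite theta_action_rep.
now rewrite tensorm_id, comp_idl, comp_idr.
Qed.

Lemma is_act_morphism_idm_to (A : action M) :
  is_act_morphism (A := theta_ob theta_is_action (action_rep A (allP _)))
    (A' := A) (idm (act_ob A)).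
Proof.
unfold is_act_morphism.
change (act_mor (theta_ob theta_is_action (action_rep A (allP (act_ob A)))))
  with (theta H (rep_mor (action_rep A (allP (act_ob A))))).
rewrite theta_action_rep; now rewrite tensorm_id, comp_idl, comp_idr.
Qed.

Lemma is_act_morphism_idm_from (A : action M) :
  is_act_morphism (A := A)
    (A' := theta_ob theta_is_action (action_rep A (allP _))) (idm (act_ob A)).
Proof.
unfold is_act_morphism.
change (act_mor (theta_ob theta_is_action (action_rep A (allP (act_ob A)))))
  with (theta H (rep_mor (action_rep A (allP (act_ob A))))).
rewrite theta_action_rep; now rewrite tensorm_id, comp_idl, comp_idr.
Qed.

Lemma theta_functor_is_equivalence :
  is_equivalence (theta_functor theta_is_act_morphism).
Proof.
exists action_rep_functor; split; constructor.
- unshelve refine (@NatIso _ _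
    (comp_functor action_rep_functor (theta_functor theta_is_act_morphism))
    (id_functor (Rep H M)) (fun R : representation H M =>
    @Iso (Rep H M) (action_rep (theta_ob theta_is_action R) (allP _)) R
      (exist _ _ (is_rep_morphism_idm_to R))
      (exist _ _ (is_rep_morphism_idm_from R)) _ _) _);
    intros; apply sig_eq; simpl; now rewrite ?comp_idl, ?comp_idr.
- unshelve refine (@NatIso _ _
    (comp_functor (theta_functor theta_is_act_morphism) action_rep_functor)
    (id_functor (Lact M)) (fun A : action M =>
    @Iso (Lact M) (theta_ob theta_is_action (action_rep A (allP _))) A
      (exist _ _ (is_act_morphism_idm_to A))
      (exist _ _ (is_act_morphism_idm_from A)) _ _) _);
    intros; apply sig_eq; simpl; now rewrite ?comp_idl, ?comp_idr.
Qed.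

End AllObjects.
End Transposition.

Theorem theorem3p6 (C : symmetric_monoidal_category) (M : monoid C) :
  (forall (P : C -> Prop) (H : internal_homs P),
     exists (Hob : forall R : representation H M,
               is_action (theta H (rep_mor R)))
            (Hmor : forall (R R' : representation H M)
                      (f : @Hom C (rep_ob R) (rep_ob R')),
               is_rep_morphism f ->
               is_act_morphism (A := theta_ob Hob R) (A' := theta_ob Hob R') f),
       fully_faithful (theta_functor Hmor) /\
       injective_on_objects (theta_functor Hmor)) /\
  (forall cl : closed C,
     exists (Hob : forall R : representation (closed_internal_homs cl) M,
               is_action (theta (closed_internal_homs cl) (rep_mor R)))
            (Hmor : forall (R R' : representation (closed_internal_homs cl) M)
                      (f : @Hom C (rep_ob R) (rep_ob R')),
               is_rep_morphism f ->
               is_act_morphism (A := theta_ob Hob R) (A' := theta_ob Hob R') f),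
       is_equivalence (theta_functor Hmor)).
Proof.
split.
- intros P H; exists theta_is_action, theta_is_act_morphism; split.
  + apply theta_functor_fully_faithful.
  + apply theta_functor_injective_on_objects.
- intros cl; exists theta_is_action, theta_is_act_morphism.
  now apply theta_functor_is_equivalence.
Qed.
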